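(* Let $A_1,\dots,A_m$ be real symmetric $n\times n$ matrices, let $b=(b_1,\dots,b_m)^T\in\mathbb{R}^m$ with $b\neq 0$, and let $r\ge 0$ be a real number. Then $b\in \mathbf{C}(r)$ if and only if $b\in\mathbf{P}(r)$. In particular, $b\in\mathbf{C}$ if and only if $b\in\mathbf{P}$.
   Context: For $x\in\mathbb{R}^n$ put $q_i(x)=x^TA_ix$ and $Q(x)=(q_1(x),\dots,q_m(x))^T\in\mathbb{R}^m$. For real symmetric $n\times n$ matrices $X,Y$, $X\bullet Y=Tr(XY)=\sum_{i,j}x_{ij}y_{ij}$, and $X\succeq 0$ means $X$ is real symmetric and positive semidefinite. Put $\mathbf{A}(X)=(A_1\bullet X,\dots,A_m\bullet X)^T$. Define $$\mathbf{P}=\{\mathbf{A}(X): X\succeq 0\},\qquad \mathbf{P}(r)=\{\mathbf{A}(X): X\succeq 0,\ Tr(X)\le r^2\},$$ $$\mathbf{C}=conv(\{Q(x):x\in\mathbb{R}^n\})=\Big\{\sum_{i=1}^t\alpha_iQ(x_i): \sum_{i=1}^t\alpha_i=1,\ \alpha_i\ge 0,\ x_i\in\mathbb{R}^n\Big\},$$ $$\mathbf{C}(r)=\Big\{\sum_{i=1}^t\alpha_iQ(x_i): \sum_{i=1}^t\alpha_i=1,\ \alpha_i\ge 0,\ x_i\in\mathbb{R}^n,\ \Vert x_i\Vert\le r\Big\}=conv(\{Q(x):\Vert x\Vert\le r\}),$$ where $t\ge 1$ ranges over all positive integers and $\Vert\cdot\Vert$ is the Euclidean norm. *)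

(* Defs.v *)
From mathcomp Require Import all_boot all_order all_algebra.
From mathcomp Require Import classical_sets reals.

Set Implicit Arguments.
Unset Strict Implicit.
Unset Printing Implicit Defensive.

Import Order.TTheory GRing.Theory Num.Theory.

Local Open Scope classical_set_scope.
Local Open Scope ring_scope.

Section Definitions.
Variable R : realType.

(* The library norm on ['cV[R]_n] is the sup norm, hence this definition. *)
Definition eucl_norm n (x : 'cV[R]_n) : R := Num.sqrt (\sum_i x i 0 ^+ 2).

Definition quad_form n (A : 'M[R]_n) (x : 'cV[R]_n) : R :=
  (x^T *m A *m x) 0 0.

Definition psd n (X : 'M[R]_n) : Prop :=
  X \is symmetricmx /\ forall x : 'cV[R]_n, 0 <= quad_form X x.

Definition trace_prod n (X Y : 'M[R]_n) : R := \tr (X *m Y).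

Definition conv d (S : set 'cV[R]_d) : set 'cV[R]_d :=
  [set y | exists (t : nat) (alpha : 'I_t -> R) (z : 'I_t -> 'cV[R]_d),
     [/\ (0 < t)%N, \sum_i alpha i = 1, forall i, 0 <= alpha i,
         forall i, S (z i) & y = \sum_i alpha i *: z i]].

Section Family.
Variables (m n : nat) (A : 'I_m -> 'M[R]_n).

Definition quad_map (x : 'cV[R]_n) : 'cV[R]_m := \col_i quad_form (A i) x.

Definition lin_map (X : 'M[R]_n) : 'cV[R]_m := \col_i trace_prod (A i) X.

Definition Pset : set 'cV[R]_m := [set lin_map X | X in [set X | psd X]].

Definition Pset_r (r : R) : set 'cV[R]_m :=
  [set lin_map X | X in [set X | psd X /\ \tr X <= r ^+ 2]].

Definition Cset : set 'cV[R]_m := conv (range quad_map).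

Definition Cset_r (r : R) : set 'cV[R]_m :=
  conv [set quad_map x | x in [set x | eucl_norm x <= r]].

End Family.

Lemma symmetricmxE n (X : 'M[R]_n) : (X \is symmetricmx) = (X^T == X).
Proof.
by rewrite is_hermitianmxE expr0 scale1r map_mx_id // eq_sym.
Qed.

Lemma trace_prodE n (X Y : 'M[R]_n) : Y \is symmetricmx ->
  trace_prod X Y = \sum_i \sum_j X i j * Y i j.
Proof.
rewrite symmetricmxE => /eqP symY; rewrite /trace_prod /mxtrace.
apply: eq_bigr => i _; rewrite mxE; apply: eq_bigr => j _.
by rewrite -[in LHS]symY mxE.
Qed.

Lemma conv_imageE d e (f : 'cV[R]_d -> 'cV[R]_e) (D : set 'cV[R]_d) y :
  conv (f @` D) y <->
  exists (t : nat) (alpha : 'I_t -> R) (x : 'I_t -> 'cV[R]_d),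
     [/\ (0 < t)%N, \sum_i alpha i = 1, forall i, 0 <= alpha i,
         forall i, D (x i) & y = \sum_i alpha i *: f (x i)].
Proof.
split=> [[t [a [z [t0 a1 a0 zD ->]]]]|[t [a [x [t0 a1 a0 xD ->]]]]].
  have x_ i : {x | D x & f x = z i} by apply: boolp.cid2; exact: zD.
  exists t, a, (fun i => s2val (x_ i)); split=> // [i|].
    exact: (s2valP (x_ i)).
  by apply: eq_bigr => i _; rewrite (s2valP' (x_ i)).
by exists t, a, (f \o x); split=> // i; exists (x i).
Qed.

End Definitions.

(* Main.v *)
Require Import Defs.
From mathcomp Require Import all_boot all_order all_algebra.
From mathcomp Require Import classical_sets reals.
From mathcomp Require Import ring lra.

Set Implicit Arguments.
Unset Strict Implicit.
Unset Printing Implicit Defensive.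

Import Order.TTheory GRing.Theory Num.Theory.

Local Open Scope classical_set_scope.
Local Open Scope ring_scope.

(** The easy direction sends [sum_k a_k Q(x_k)] to [X = sum_k a_k x_k x_k^T].
Conversely, a positive semidefinite [X] is a sum of squares [x_k x_k^T], obtained
by taking Schur complements at nonzero diagonal entries one after the other. If
[T = tr X = sum_k |x_k|^2] is positive, the weights [|x_k|^2 / T] sum to [1], and
[Q] is homogeneous of degree two, so [A(X) = sum_k Q(x_k)] is the convex
combination with these weights of the values of [Q] at the vectors
[(sqrt T / |x_k|) x_k], of norm [sqrt T] (or zero if [x_k = 0]). *)

(** * Positive semidefinite matrices as sums of rank-one squares *)

Section QuadraticForms.
Variables (R : realType) (n : nat).
Implicit Types (A X : 'M[R]_n) (x y : 'cV[R]_n).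

Lemma eucl_norm_sqr x : eucl_norm x ^+ 2 = \sum_i x i 0 ^+ 2.
Proof. by rewrite sqr_sqrtr // sumr_ge0 // => i _; rewrite sqr_ge0. Qed.

Lemma eucl_norm_eq0 x : eucl_norm x = 0 -> x = 0.
Proof.
move=> x0; apply/colP => i; rewrite mxE; apply/eqP; rewrite -sqrf_eq0.
have /psumr_eq0P -> // : \sum_i x i 0 ^+ 2 = 0.
  by rewrite -eucl_norm_sqr x0 expr0n.
by move=> j _; rewrite sqr_ge0.
Qed.

Lemma eucl_normZ a x : eucl_norm (a *: x) = `|a| * eucl_norm x.
Proof.
rewrite /eucl_norm -sqrtr_sqr -sqrtrM ?sqr_ge0// mulr_sumr; congr Num.sqrt.
by apply: eq_bigr => i _; rewrite mxE exprMn.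
Qed.

Lemma mxtrace_outer x : \tr (x *m x^T) = eucl_norm x ^+ 2.
Proof.
rewrite eucl_norm_sqr; apply: eq_bigr => i _.
by rewrite mxE big_ord1 mxE expr2.
Qed.

(** Cyclicity of the trace. This identifies [quad_map A x] with [lin_map A (x *m x^T)], the link
    between the two sides of the theorem. *)
Lemma trace_prod_outer A x : trace_prod A (x *m x^T) = quad_form A x.
Proof.
by rewrite /trace_prod mulmxA mxtrace_mulC mulmxA /mxtrace big_ord1.
Qed.

Lemma quad_formZ A a x : quad_form A (a *: x) = a ^+ 2 * quad_form A x.
Proof.
rewrite /quad_form [(a *: x)^T]linearZ /= -!scalemxAl -scalemxAr scalerA -expr2.
by rewrite [LHS]mxE.
Qed.

Lemma quad_form_outer x y : quad_form (y *m y^T) x = ((y^T *m x) 0 0) ^+ 2.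
Proof.
rewrite /quad_form mulmxA -mulmxA mxE big_ord1 expr2; congr (_ * _).
by rewrite -[in LHS](trmxK (x^T *m y)) mxE trmx_mul trmxK.
Qed.

Lemma quad_formDZ X x y c : X \is symmetricmx ->
  quad_form X (x + c *: y) =
  quad_form X x + c * (y^T *m X *m x) 0 0 *+ 2 + c ^+ 2 * quad_form X y.
Proof.
rewrite symmetricmxE => /eqP symX.
have : (x^T *m X *m y) 0 0 = (y^T *m X *m x) 0 0.
  rewrite -[in LHS](trmxK (x^T *m X *m y)) mxE.
  by rewrite !trmx_mul trmxK symX mulmxA.
rewrite /quad_form [(x + _)^T]linearD /= [(c *: y)^T]linearZ /= !mulmxDl !mulmxDr.
rewrite -!scalemxAl -!scalemxAr.
move: (x^T *m X *m y) (y^T *m X *m x) (x^T *m X *m x) (y^T *m X *m y).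
by move=> u v w z uv; rewrite !mxE uv; ring.
Qed.

Lemma quad_form_delta X i : quad_form X (delta_mx i 0) = X i i.
Proof. by rewrite /quad_form trmx_delta -rowE -colE !mxE. Qed.

Lemma psd_diag_ge0 X i : psd X -> 0 <= X i i.
Proof. by move=> [_ /(_ (delta_mx i 0))]; rewrite quad_form_delta. Qed.

(** With a zero diagonal, the form at [e_j + c *: e_i] is [2 * c * X i j], linear in [c];
    nonnegativity at [c = 1] and [c = -1] forces [X i j = 0]. This ends the elimination in
    [psd_sum_outer]. *)
Lemma psd_diag0 X : psd X -> (forall i, X i i = 0) -> X = 0.
Proof.
move=> [symX Xge0] X0; apply/matrixP => i j; rewrite [RHS]mxE.
have ge0 c : 0 <= c * X i j *+ 2.
  have := Xge0 (delta_mx j 0 + c *: delta_mx i 0).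
  rewrite quad_formDZ // !quad_form_delta !X0 mulr0 add0r addr0.
  by rewrite trmx_delta -rowE -colE !mxE.
by have := ge0 1; have := ge0 (-1); lra.
Qed.

Lemma psd0 : psd (0 : 'M[R]_n).
Proof.
split=> [|x]; first by rewrite symmetricmxE trmx0.
by rewrite /quad_form mulmx0 mul0mx mxE.
Qed.

Lemma psd_outer x : psd (x *m x^T).
Proof.
split=> [|y]; first by rewrite symmetricmxE trmx_mul trmxK.
by rewrite quad_form_outer sqr_ge0.
Qed.

Lemma quad_formD X Y x : quad_form (X + Y) x = quad_form X x + quad_form Y x.
Proof. by rewrite /quad_form mulmxDr mulmxDl [LHS]mxE. Qed.

Lemma quad_formZl c X x : quad_form (c *: X) x = c * quad_form X x.
Proof. by rewrite /quad_form -scalemxAr -scalemxAl [LHS]mxE. Qed.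

Lemma psdD X Y : psd X -> psd Y -> psd (X + Y).
Proof.
move=> [symX X0] [symY Y0]; split=> [|x]; last by rewrite quad_formD addr_ge0.
move: symX symY; rewrite !symmetricmxE linearD /= => /eqP -> /eqP ->.
exact: eqxx.
Qed.

Lemma psdZ c X : 0 <= c -> psd X -> psd (c *: X).
Proof.
move=> c0 [symX X0]; split=> [|x]; last by rewrite quad_formZl mulr_ge0.
by move: symX; rewrite !symmetricmxE linearZ /= => /eqP ->.
Qed.

Lemma psd_schur X i : psd X -> X i i != 0 ->
  psd (X - (X i i)^-1 *: (col i X *m (col i X)^T)).
Proof.
move=> [symX X0] Xii; split=> [|x].
  move: symX; rewrite !symmetricmxE linearB linearZ /= trmx_mul trmxK.
  by move/eqP => ->.
rewrite quad_formD -scaleNr quad_formZl quad_form_outer.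
have -> : (col i X)^T *m x = 'e_i *m X *m x.
  rewrite -rowE tr_col; move: symX; rewrite symmetricmxE.
  by move/eqP => ->.
(* The minimum over [c] of the quadratic form at [x + c *: e_i]. *)
have := X0 (x + - ((X i i)^-1 * ('e_i *m X *m x) (0 : 'I_1) 0) *: delta_mx i 0).
rewrite quad_formDZ // quad_form_delta trmx_delta.
move: (_ *m x) => u; apply: etrans; congr (0 <= _).
by field.
Qed.

(** Induction on the number of nonzero diagonal entries: passing to the Schur complement at [i]
    clears entry [i] and creates no new nonzero diagonal entry. *)
Lemma psd_sum_outer X : psd X ->
  exists s : seq 'cV[R]_n, X = \sum_(x <- s) x *m x^T.
Proof.
have [k] := ubnP #|[pred i | X i i != 0]|.
elim: k X => // k IHk X Xk psdX.
have [/existsP[i Xii]|/existsPn X0] := boolP [exists i, X i i != 0]; last first.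
  exists [::]; rewrite big_nil; apply: psd_diag0 => // i.
  by apply/eqP/negPn/X0.
pose v := col i X; pose Y := X - (X i i)^-1 *: (v *m v^T).
have psdY : psd Y by exact: psd_schur.
have Xii0 : 0 <= X i i by exact: psd_diag_ge0.
have Yjj j : Y j j = X j j - (X i i)^-1 * X j i ^+ 2.
  by rewrite !mxE big_ord1 !mxE expr2.
have [|s sY] := IHk Y _ psdY.
  rewrite -ltnS; apply: leq_trans Xk; rewrite ltnS; apply/proper_card/properP; split.
    (* If [X j j = 0], then [Y j j] is minus a nonnegative number, yet nonnegative because [Y] is
       positive semidefinite. *)
    apply/fintype.subsetP => j; rewrite !inE; apply: contraNN => /eqP Xjj.
    rewrite eq_le psd_diag_ge0 // andbT Yjj Xjj sub0r oppr_le0.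
    by rewrite mulr_ge0 ?invr_ge0 // sqr_ge0.
  exists i; rewrite !inE // Yjj negbK expr2 mulKf // subrr.
  exact: eqxx.
(* The square root absorbs the positive coefficient of [v *m v^T] into the vector. *)
exists (Num.sqrt (X i i)^-1 *: v :: s); rewrite big_cons -sY.
rewrite linearZ /= -scalemxAl -scalemxAr scalerA -expr2.
by rewrite sqr_sqrtr ?invr_ge0 // addrC subrK.
Qed.

End QuadraticForms.

(** * Passing between convex combinations and semidefinite matrices *)

Section ConvexHull.
Variables (R : realType) (m n : nat) (A : 'I_m -> 'M[R]_n).

Lemma lin_map_sum_outer (I : Type) (s : seq I) (a : I -> R) (x : I -> 'cV[R]_n) :
  lin_map A (\sum_(i <- s) a i *: (x i *m (x i)^T)) =
  \sum_(i <- s) a i *: quad_map A (x i).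
Proof.
apply/colP => k; rewrite summxE mxE /trace_prod mulmx_sumr raddf_sum /=.
apply: eq_bigr => i _.
by rewrite -scalemxAr linearZ /= !mxE -trace_prod_outer.
Qed.

Lemma convex_comb_psd (t : nat) (a : 'I_t -> R) (x : 'I_t -> 'cV[R]_n) :
  (forall i, 0 <= a i) ->
  exists2 X, psd X & \tr X = \sum_i a i * eucl_norm (x i) ^+ 2 /\
    lin_map A X = \sum_i a i *: quad_map A (x i).
Proof.
move=> a0; exists (\sum_i a i *: (x i *m (x i)^T)).
  apply: big_ind => [|X Y|i _]; [exact: psd0 | exact: psdD |].
  by apply: psdZ => //; exact: psd_outer.
split; last exact: lin_map_sum_outer.
rewrite raddf_sum; apply: eq_bigr => i _.
by rewrite [LHS]mxtraceZ mxtrace_outer.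
Qed.

(** The bound by [Num.sqrt (\tr X)] is independent of [r], so the lemma serves both the bounded and
    the unbounded case. *)
Lemma psd_convex_comb (X : 'M[R]_n) : psd X -> lin_map A X != 0 ->
  exists (t : nat) (a : 'I_t -> R) (x : 'I_t -> 'cV[R]_n),
    [/\ (0 < t)%N, \sum_i a i = 1, forall i, 0 <= a i,
        forall i, eucl_norm (x i) <= Num.sqrt (\tr X)
      & lin_map A X = \sum_i a i *: quad_map A (x i)].
Proof.
move=> psdX AX0; have [s sX] := psd_sum_outer psdX.
pose t := size s; pose z (i : 'I_t) : 'cV[R]_n := s`_i; pose T := \tr X.
have Xz : X = \sum_i 1 *: (z i *m (z i)^T).
  rewrite sX (big_nth 0) big_mkord; apply: eq_bigr => i _.
  by rewrite scale1r.
have Tz : T = \sum_i eucl_norm (z i) ^+ 2.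
  rewrite /T Xz raddf_sum; apply: eq_bigr => i _.
  by rewrite scale1r [LHS]mxtrace_outer.
(* A zero trace would make every [z i] zero, hence [lin_map A X = 0]. This is where [b] being
   nonzero enters. *)
have T0 : T != 0.
  apply: contraNneq AX0 => T0; apply/eqP.
  rewrite Xz lin_map_sum_outer big1 // => i _.
  have /eucl_norm_eq0 -> : eucl_norm (z i) = 0.
    apply/eqP; rewrite -sqrf_eq0; apply/eqP.
    by move: i isT; apply: psumr_eq0P => [i _|]; rewrite ?sqr_ge0 -?Tz.
  by apply/colP => k; rewrite !mxE /quad_form mulmx0 mxE mulr0.
have Tge0 : 0 <= T by rewrite Tz sumr_ge0 // => i _; rewrite sqr_ge0.
exists t, (fun i => eucl_norm (z i) ^+ 2 / T).
exists (fun i => (Num.sqrt T / eucl_norm (z i)) *: z i); split.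
- rewrite lt0n; apply: contraNneq T0 => t0; rewrite Tz big1 // => i.
  by have := leq_ltn_trans (leq0n i) (ltn_ord i); rewrite [X in (_ < X)%N]t0.
- by rewrite -mulr_suml -Tz divff.
- by move=> i; rewrite divr_ge0 ?sqr_ge0.
- move=> i; rewrite eucl_normZ normrM normfV !ger0_norm ?sqrtr_ge0 // -mulrA.
  (* Division by zero yields zero, so a zero [z i] is sent to the zero vector; any other [z i] gets
     norm exactly [Num.sqrt T]. *)
  have [->|z0] := eqVneq (eucl_norm (z i)) 0; last by rewrite mulVf // mulr1.
  by rewrite !mulr0 sqrtr_ge0.
rewrite {1}Xz lin_map_sum_outer; apply: eq_bigr => i _; rewrite scale1r.
apply/colP => k; rewrite !mxE quad_formZ exprMn (sqr_sqrtr Tge0).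
(* The weight times the squared scaling factor is [1] when [z i] is nonzero; otherwise both sides
   vanish. *)
have [z0|z0] := eqVneq (eucl_norm (z i)) 0; last by field; rewrite T0 z0.
by rewrite z0 (eucl_norm_eq0 z0) /quad_form mulmx0 mxE !mulr0.
Qed.

End ConvexHull.

Theorem theorem1 (R : realType) (m n : nat) (A : 'I_m -> 'M[R]_n)
    (A_sym : forall i, A i \is symmetricmx)
    (b : 'cV[R]_m) (b_neq0 : b <> 0) :
  (forall r : R, 0 <= r -> (Cset_r A r b <-> Pset_r A r b)) /\
  (Cset A b <-> Pset A b).
Proof.
split=> [r r0|]; split.
- move=> /conv_imageE[t [a [x [_ a1 a0 xr ->]]]].
  have [X psdX [trX AX]] := convex_comb_psd A x a0.
  (* As the weights sum to [1], [r ^+ 2] is itself the weighted sum of copies of [r ^+ 2], and the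
     traces compare term by term. *)
  exists X => //; split=> //; rewrite trX -[leRHS]mul1r -a1 mulr_suml.
  apply: ler_sum => i _; apply: ler_wpM2l => //.
  by rewrite lerXn2r ?nnegrE // ?sqrtr_ge0 //; exact: xr.
- move=> [X [psdX trX] AXb]; apply/conv_imageE.
  have [|t [a [x [t0 a1 a0 xX AX]]]] := psd_convex_comb (A := A) psdX.
    by rewrite AXb; apply/eqP.
  exists t, a, x; split=> [//|//|//|i|]; last by rewrite -AXb.
  apply: le_trans (xX i) _.
  by rewrite -(ger0_norm r0) -sqrtr_sqr ler_wsqrtr.
- move=> /conv_imageE[t [a [x [_ _ a0 _ ->]]]].
  by have [X psdX [_ AX]] := convex_comb_psd A x a0; exists X.
- move=> [X psdX AXb]; apply/conv_imageE.
  have [|t [a [x [t0 a1 a0 _ AX]]]] := psd_convex_comb (A := A) psdX.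
    by rewrite AXb; apply/eqP.
  by exists t, a, x; split=> //; rewrite -AXb.
Qed.
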